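(* Let $\mathcal{B}=\{u_1,\dots,u_N\}$ be an orthonormal basis of $\mathbb{K}^N$, with associated unitary matrix $U$, let $X$ be a Banach space over $\mathbb{K}$, and let $f\in X^N\setminus\{0\}$. Then, for every $p\in[1,\infty]$ with conjugate exponent $p'$, $$\frac{\|f\|_p\,\|\hat f\|_p}{\|f\|_\infty\,\|\hat f\|_\infty}\ge\frac{1}{\kappa_{p'}(U)\,\kappa_{p'}(U^* )} .$$ In particular, $$\frac{\|f\|_1\,\|\hat f\|_1}{\|f\|_\infty\,\|\hat f\|_\infty}\ge\frac{1}{\kappa(U)^2},\qquad \frac{\|f\|_2\,\|\hat f\|_2}{\|f\|_\infty\,\|\hat f\|_\infty}\ge1 .$$
   Context: $\mathbb{K}$ is $\mathbb{R}$ or $\mathbb{C}$, $N\ge 1$. An $X$-valued signal is a function $f:\{1,\dots,N\}\to X$, identified with $(f(1),\dots,f(N))\in X^N$. Norms: $\|f\|_p=\left(\sum_{n=1}^N\|f(n)\|^p\right)^{1/p}$ for $p\in[1,\infty)$ and $\|f\|_\infty=\max_{1\le n\le N}\|f(n)\|$. $U$ is the $N\times N$ unitary matrix whose $k$-th column is $u_k=(u_k(1),\dots,u_k(N))$, i.e. its entry in row $n$, column $k$ is $u_k(n)$; its $n$-th row is $u(n)=(u_1(n),\dots,u_N(n))$; $U^*$ is its conjugate transpose. Graph Fourier transform of $f$: $\hat f\in X^N$, $\hat f(k)=\sum_{n=1}^N\overline{u_k(n)}f(n)$. Coherence: $\kappa(U)=\max_{k,n}|u_k(n)|$, and for $r\in[1,\infty]$,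 $\kappa_r(U)=\max_{1\le k\le N}\|u_k\|_r$ with the usual $\ell^r$ norm on $\mathbb{K}^N$ (maximum over columns); hence $\kappa_r(U^* )=\max_{1\le n\le N}\|u(n)\|_r$. The conjugate exponent satisfies $1/p+1/p'=1$. *)

(* Defs.v *)
From HB Require Import structures.
From mathcomp Require Import all_boot all_order all_algebra.
From mathcomp Require Import complex.
From mathcomp Require Import all_classical all_reals all_analysis.

Set Implicit Arguments.
Unset Strict Implicit.
Unset Printing Implicit Defensive.

Import Order.TTheory GRing.Theory Num.Theory.
Import numFieldNormedType.Exports.

Local Open Scope ring_scope.

Variant scalar_kind := RealScalars | ComplexScalars.

Definition scalar_field (R : realType) (k : scalar_kind) : numFieldType :=
  match k with
  | RealScalars => R
  | ComplexScalars => R[i]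
  end.

Definition sconj (R : realType) (k : scalar_kind) :
    scalar_field R k -> scalar_field R k :=
  match k with
  | RealScalars => id
  | ComplexScalars => @conjc R
  end.

Definition sRe (R : realType) (k : scalar_kind) : scalar_field R k -> R :=
  match k with
  | RealScalars => id
  | ComplexScalars => @complex.Re R
  end.

(* In the library the norm of a normed space over [K] takes its values in [K],
   where it is real and nonnegative; [rnorm x] is that value as an element of
   [R]. On a scalar it is the modulus. *)
Definition rnorm (R : realType) (k : scalar_kind)
    (V : normedZmodType (scalar_field R k)) (x : V) : R :=
  sRe `|x|.

(* The exponent ranges over [1, +oo]; the value at [-oo] is irrelevant. *)
Definition lpnorm (R : realType) (k : scalar_kind)
    (V : normedZmodType (scalar_field R k)) (N : nat) (p : \bar R)
    (v : 'I_N -> V) : R :=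
  match p with
  | EFin r => (\sum_(n < N) rnorm (v n) `^ r) `^ r^-1
  | +oo%E => \big[Num.max/0]_(n < N) rnorm (v n)
  | -oo%E => 0
  end.

Definition inner (R : realType) (k : scalar_kind) (N : nat)
    (x y : 'cV[scalar_field R k]_N) : scalar_field R k :=
  \sum_(n < N) x n ord0 * sconj (y n ord0).

Definition orthonormal_basis (R : realType) (k : scalar_kind) (N : nat)
    (u : 'I_N -> 'cV[scalar_field R k]_N) : Prop :=
  (forall i j : 'I_N, inner (u i) (u j) = (i == j)%:R) /\
  basis_of fullv [seq u j | j <- enum 'I_N].

Definition basis_mx (R : realType) (k : scalar_kind) (N : nat)
    (u : 'I_N -> 'cV[scalar_field R k]_N) : 'M[scalar_field R k]_N :=
  \matrix_(n < N, j < N) u j n ord0.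

Definition conj_trmx (R : realType) (k : scalar_kind) (N : nat)
    (U : 'M[scalar_field R k]_N) : 'M[scalar_field R k]_N :=
  map_mx (@sconj R k) U^T.

Definition gft (R : realType) (k : scalar_kind) (N : nat)
    (u : 'I_N -> 'cV[scalar_field R k]_N) (X : normedModType (scalar_field R k))
    (f : {ffun 'I_N -> X}) : {ffun 'I_N -> X} :=
  [ffun j => \sum_(n < N) sconj (u j n ord0) *: f n].

Definition coherence (R : realType) (k : scalar_kind) (N : nat)
    (U : 'M[scalar_field R k]_N) : R :=
  \big[Num.max/0]_(j < N) \big[Num.max/0]_(n < N) rnorm (U n j).

(* The maximum is over the columns of [U]. *)
Definition coherence_r (R : realType) (k : scalar_kind) (N : nat) (r : \bar R)
    (U : 'M[scalar_field R k]_N) : R :=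
  \big[Num.max/0]_(j < N) lpnorm r (fun n : 'I_N => U n j).

(* Main.v *)
Require Import Defs.
From HB Require Import structures.
From mathcomp Require Import all_boot all_order all_algebra.
From mathcomp Require Import complex.
From mathcomp Require Import all_classical all_reals all_analysis.

Set Implicit Arguments.
Unset Strict Implicit.
Unset Printing Implicit Defensive.

Import Order.TTheory GRing.Theory Num.Theory.
Import numFieldNormedType.Exports.

Local Open Scope ring_scope.

(** Both the transform and its inverse are sums against the entries of a
unitary matrix.  Each value of the transform is a sum over n of the conjugate
of u_j(n) times f(n), so the triangle inequality and Hoelder's inequality bound
it by the p'-norm of the j-th column of U times the p-norm of f.  Taking the
maximum over j gives

  |fhat|_oo <= kappa_p'(U) |f|_p.

Since U is unitary, f(n) is the sum over j of u_j(n) times fhat(j)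
([gft_inversion]), and the same argument with the conjugate transpose of U
gives

  |f|_oo <= kappa_p'(U^* ) |fhat|_p.

Both are instances of [lpnorm_infty_le_coherence_r].  Their product
([lpnorm_infty_mul_le]) is the claim, once one knows that the two sup norms do
not vanish: f is nonzero, and so is its transform, again by inversion.

For p = 1 the exponent p' is infinite, and both coherences are bounded by the
largest modulus of an entry of U.  For p = 2 both are bounded by 1, because the
columns of U and of its conjugate transpose are unit vectors. *)

(** * Moduli and norms as real numbers *)

Lemma sconjK (R : realType) (k : scalar_kind) : involutive (@sconj R k).
Proof. by case: k => //=; exact: conjcK. Qed.

Lemma sRe_sum (R : realType) (k : scalar_kind) (N : nat)
    (a : 'I_N -> scalar_field R k) :
  sRe (\sum_(n < N) a n) = \sum_(n < N) sRe (a n).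
Proof. by case: k a => //= a; rewrite raddf_sum. Qed.

Lemma sRe_nat (R : realType) (k : scalar_kind) (b : nat) :
  sRe (b%:R : scalar_field R k) = b%:R.
Proof. by case: k => //=; rewrite raddfMn. Qed.

Lemma rnorm_ge0 (R : realType) (k : scalar_kind)
    (V : normedZmodType (scalar_field R k)) (x : V) : 0 <= rnorm x.
Proof.
rewrite /rnorm; have := normr_ge0 x; case: k V x => //= V x.
by rewrite lecE => /andP[].
Qed.

Lemma rnorm0 (R : realType) (k : scalar_kind)
    (V : normedZmodType (scalar_field R k)) : rnorm (0 : V) = 0.
Proof. by rewrite /rnorm normr0; case: k V. Qed.

(** The scalar [`|x|] is nonnegative, so it has no imaginary part and vanishes
with its real part. *)
Lemma rnorm_eq0 (R : realType) (k : scalar_kind)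
    (V : normedZmodType (scalar_field R k)) (x : V) : rnorm x = 0 -> x = 0.
Proof.
rewrite /rnorm => x0; apply: normr0_eq0; have := normr_ge0 x.
case: k V x x0 => //= V x; case: `|x| => a b /= ->.
by rewrite lecE /= => /andP[/eqP ->].
Qed.

Lemma rnormD (R : realType) (k : scalar_kind)
    (V : normedZmodType (scalar_field R k)) (x y : V) :
  rnorm (x + y) <= rnorm x + rnorm y.
Proof.
rewrite /rnorm; have := ler_normD x y; case: k V x y => //= V x y.
by rewrite lecE => /andP[_]; rewrite raddfD.
Qed.

Lemma rnorm_sum (R : realType) (k : scalar_kind)
    (V : normedZmodType (scalar_field R k)) (N : nat) (x : 'I_N -> V) :
  rnorm (\sum_(n < N) x n) <= \sum_(n < N) rnorm (x n).
Proof.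
elim/big_ind2 : _ => [|a x' b y' ax by_|//]; first by rewrite rnorm0.
by rewrite (le_trans (rnormD _ _))// lerD.
Qed.

Lemma rnormZ (R : realType) (k : scalar_kind)
    (V : normedModType (scalar_field R k)) (a : scalar_field R k) (x : V) :
  rnorm (a *: x) = rnorm a * rnorm x.
Proof.
rewrite /rnorm normrZ; have := normr_ge0 x.
case: k V a x => //= V a x.
case: `|x| => c d; rewrite lecE /= => /andP[/eqP -> _].
by case: a => a b /=; rewrite mul0r subr0.
Qed.

Lemma rnorm_sconj (R : realType) (k : scalar_kind) (a : scalar_field R k) :
  rnorm (sconj a) = rnorm a.
Proof. by rewrite /rnorm; case: k a => //= -[a b] /=; rewrite sqrrN. Qed.

Lemma rnorm_sqr (R : realType) (k : scalar_kind) (a : scalar_field R k) :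
  rnorm a ^+ 2 = sRe (a * sconj a).
Proof.
rewrite /rnorm; case: k a => /= a; first by rewrite real_normK ?num_real.
by case: a => a b; rewrite /= sqr_sqrtr ?addr_ge0 ?sqr_ge0// mulrN opprK.
Qed.

(** * Hoelder's inequality for finite families *)

(** Induction from the two-term inequality: the tail sums are the powers of
their own roots, so appending a term is a two-term instance. *)
Lemma hoelder_sum (R : realType) (I : Type) (s : seq I) (a b : I -> R)
    (p q : R) :
  (forall i, 0 <= a i) -> (forall i, 0 <= b i) ->
  0 < p -> 0 < q -> p^-1 + q^-1 = 1 ->
  \sum_(i <- s) a i * b i <=
  (\sum_(i <- s) a i `^ p) `^ p^-1 * (\sum_(i <- s) b i `^ q) `^ q^-1.
Proof.
move=> a0 b0 p0 q0 pq; elim: s => [|i s IH].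
  by rewrite !big_nil mulr_ge0// powR_ge0.
rewrite !big_cons.
have rootK (t : R) (c : I -> R) : 0 < t ->
    \sum_(j <- s) c j `^ t = ((\sum_(j <- s) c j `^ t) `^ t^-1) `^ t.
  move=> t0; rewrite -powRrM mulVf ?gt_eqF// powRr1//.
  by rewrite sumr_ge0// => j _; rewrite powR_ge0.
rewrite (rootK p a p0) (rootK q b q0).
apply: le_trans (hoelder2 _ _ _ _ p0 q0 pq) => //; rewrite ?powR_ge0//.
by rewrite lerD2l.
Qed.

Lemma lpnorm_ge0 (R : realType) (k : scalar_kind)
    (V : normedZmodType (scalar_field R k)) (N : nat) (p : \bar R)
    (v : 'I_N -> V) : 0 <= lpnorm p v.
Proof.
by case: p => [r| |] //=; rewrite ?powR_ge0// bigmax_ge_id.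
Qed.

Lemma le_lpnorm_infty (R : realType) (k : scalar_kind)
    (V : normedZmodType (scalar_field R k)) (N : nat) (v : 'I_N -> V) n :
  rnorm (v n) <= lpnorm +oo%E v.
Proof. exact: (le_bigmax _ (fun n => rnorm (v n))). Qed.

Lemma lpnorm_infty_gt0 (R : realType) (k : scalar_kind)
    (V : normedZmodType (scalar_field R k)) (N : nat) (v : 'I_N -> V) n :
  v n != 0 -> 0 < lpnorm +oo%E v.
Proof.
move=> vn0; apply: lt_le_trans (le_lpnorm_infty v n).
by rewrite lt_def rnorm_ge0 andbT; apply: contra vn0 => /eqP/rnorm_eq0 ->.
Qed.

Lemma lpnorm1 (R : realType) (k : scalar_kind)
    (V : normedZmodType (scalar_field R k)) (N : nat) (v : 'I_N -> V) :
  lpnorm 1%E v = \sum_(n < N) rnorm (v n).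
Proof.
rewrite /= invr1 powRr1; last by rewrite sumr_ge0// => n _; rewrite powR_ge0.
by apply: eq_bigr => n _; rewrite powRr1// rnorm_ge0.
Qed.

(** The endpoint case of Hoelder's inequality, kept apart because it serves both
p = 1 and, with the factors exchanged, p = +oo. *)
Lemma hoelder_lpnorm_infty (R : realType) (k : scalar_kind)
    (V W : normedZmodType (scalar_field R k)) (N : nat)
    (v : 'I_N -> V) (w : 'I_N -> W) :
  \sum_(n < N) rnorm (v n) * rnorm (w n) <= lpnorm 1%E v * lpnorm +oo%E w.
Proof.
rewrite lpnorm1 mulr_suml; apply: ler_sum => n _.
by rewrite ler_wpM2l ?rnorm_ge0 ?le_lpnorm_infty.
Qed.

Lemma hoelder_lpnorm (R : realType) (k : scalar_kind)
    (V W : normedZmodType (scalar_field R k)) (N : nat) (p : \bar R)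
    (v : 'I_N -> V) (w : 'I_N -> W) :
  (1 <= p)%E ->
  \sum_(n < N) rnorm (v n) * rnorm (w n) <=
  lpnorm p v * lpnorm (hoelder_conjugate p) w.
Proof.
case: p => [p| |//] p1; last first.
  rewrite hoelder_conjugatey mulrC.
  under eq_bigr do rewrite mulrC.
  exact: hoelder_lpnorm_infty.
have [->|p_neq1] := eqVneq p 1.
  by rewrite hoelder_conjugate1; exact: hoelder_lpnorm_infty.
have p0 : 0 < p by rewrite (lt_le_trans ltr01) -?lee_fin.
have pB1 : 0 < p - 1 by rewrite subr_gt0 lt_def p_neq1 -lee_fin.
have -> : hoelder_conjugate p%:E = (p / (p - 1))%:E.
  by rewrite /hoelder_conjugate/= eqe gt_eqF// inver gt_eqF.
apply: hoelder_sum => //; try by move=> n; exact: rnorm_ge0.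
  exact: divr_gt0.
by rewrite invf_div -{1}(mul1r p^-1) -mulrDl subrKC divff// gt_eqF.
Qed.

(** * Coherence and the sup norm of a transform *)

Lemma le_coherence_r (R : realType) (k : scalar_kind) (N : nat) (r : \bar R)
    (A : 'M[scalar_field R k]_N) (j : 'I_N) :
  lpnorm r (fun n => A n j) <= coherence_r r A.
Proof. exact: (le_bigmax _ (fun j => lpnorm r (fun n => A n j))). Qed.

Lemma coherence_r_ge0 (R : realType) (k : scalar_kind) (N : nat) (r : \bar R)
    (A : 'M[scalar_field R k]_N) : 0 <= coherence_r r A.
Proof. exact: bigmax_ge_id. Qed.

(** Both the transform and its inverse have this shape, the first with the
unitary matrix and the second with its conjugate transpose. *)
Lemma lpnorm_infty_le_coherence_r (R : realType) (k : scalar_kind)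
    (X : normedModType (scalar_field R k)) (N : nat)
    (A : 'M[scalar_field R k]_N) (g h : 'I_N -> X) (p : \bar R) :
  (1 <= p)%E -> (forall j, g j = \sum_(n < N) sconj (A n j) *: h n) ->
  lpnorm +oo%E g <= coherence_r (hoelder_conjugate p) A * lpnorm p h.
Proof.
move=> p1 gE; apply: bigmax_le => [|j _].
  by rewrite mulr_ge0// ?coherence_r_ge0 ?lpnorm_ge0.
rewrite gE (le_trans (rnorm_sum _))//.
under eq_bigr do rewrite rnormZ rnorm_sconj mulrC.
rewrite (le_trans (hoelder_lpnorm _ (fun n => A n j) p1))// mulrC.
by rewrite ler_wpM2r ?lpnorm_ge0 ?le_coherence_r.
Qed.

Lemma coherence_r_infty (R : realType) (k : scalar_kind) (N : nat)
    (A : 'M[scalar_field R k]_N) : coherence_r +oo%E A = coherence A.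
Proof. by []. Qed.

(** Transposing and conjugating only rearranges the moduli of the entries. *)
Lemma coherence_conj_trmx_le (R : realType) (k : scalar_kind) (N : nat)
    (A : 'M[scalar_field R k]_N) : coherence (conj_trmx A) <= coherence A.
Proof.
apply: bigmax_le => [|j _]; first exact: bigmax_ge_id.
apply: bigmax_le => [|n _]; first exact: bigmax_ge_id.
rewrite !mxE rnorm_sconj.
apply: le_trans (le_coherence_r +oo%E A n).
exact: (le_lpnorm_infty (fun m => A m n)).
Qed.

Lemma conj_trmxK (R : realType) (k : scalar_kind) (N : nat) :
  involutive (@conj_trmx R k N).
Proof. by move=> A; apply/matrixP => i j; rewrite !mxE sconjK. Qed.

(** The diagonal of the Gram matrix holds the squared norms of the columns. *)
Lemma coherence_r2_le1 (R : realType) (k : scalar_kind) (N : nat)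
    (A : 'M[scalar_field R k]_N) :
  conj_trmx A *m A = 1%:M -> coherence_r 2%:E A <= 1.
Proof.
move=> AA; apply: bigmax_le => // j _ /=.
suff -> : \sum_(n < N) rnorm (A n j) `^ 2 = 1 by rewrite powR1.
transitivity (sRe ((conj_trmx A *m A) j j)).
  rewrite mxE sRe_sum; apply: eq_bigr => n _.
  by rewrite !mxE mulrC -rnorm_sqr powR_mulrn ?rnorm_ge0.
by rewrite AA mxE eqxx sRe_nat.
Qed.

(** * Inversion of the graph Fourier transform *)

Lemma conj_trmx_basis_mxK (R : realType) (k : scalar_kind) (N : nat)
    (u : 'I_N -> 'cV[scalar_field R k]_N) :
  orthonormal_basis u -> conj_trmx (basis_mx u) *m basis_mx u = 1%:M.
Proof.
case=> uu _; apply/matrixP => i j; rewrite mxE [RHS]mxE eq_sym -uu.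
by apply: eq_bigr => n _; rewrite !mxE mulrC.
Qed.

(** The relations between columns only say that U has a left inverse; inversion
needs the orthonormality of the rows, which follows because a one-sided inverse
of a square matrix is two-sided. *)
Lemma gft_inversion (R : realType) (k : scalar_kind) (N : nat)
    (u : 'I_N -> 'cV[scalar_field R k]_N) (X : normedModType (scalar_field R k))
    (f : {ffun 'I_N -> X}) (n : 'I_N) :
  orthonormal_basis u ->
  f n = \sum_(j < N) u j n ord0 *: gft u f j.
Proof.
move=> /conj_trmx_basis_mxK/mulmx1C UU.
transitivity (\sum_(m < N)
    (basis_mx u *m conj_trmx (basis_mx u)) n m *: f m).
  rewrite UU (bigD1 n)//= mxE eqxx scale1r big1 ?addr0// => m mn.
  by rewrite mxE eq_sym (negbTE mn) scale0r.
under [RHS]eq_bigr do rewrite ffunE scaler_sumr.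
rewrite exchange_big; apply: eq_bigr => m _; rewrite mxE scaler_suml.
by apply: eq_bigr => j _; rewrite !mxE scalerA.
Qed.

(** * The uncertainty inequality *)

Lemma lpnorm_infty_mul_le (R : realType) (k : scalar_kind) (N : nat)
    (u : 'I_N -> 'cV[scalar_field R k]_N) (X : normedModType (scalar_field R k))
    (f : {ffun 'I_N -> X}) (p : \bar R) :
  orthonormal_basis u -> (1 <= p)%E ->
  lpnorm +oo%E f * lpnorm +oo%E (gft u f) <=
  coherence_r (hoelder_conjugate p) (basis_mx u) *
  coherence_r (hoelder_conjugate p) (conj_trmx (basis_mx u)) *
  (lpnorm p f * lpnorm p (gft u f)).
Proof.
move=> u_onb p1; rewrite [leLHS]mulrC [leRHS]mulrACA.
apply: ler_pM; rewrite ?lpnorm_ge0//.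
- apply: lpnorm_infty_le_coherence_r => // j; rewrite ffunE.
  by under [RHS]eq_bigr do rewrite mxE.
- apply: lpnorm_infty_le_coherence_r => // n.
  rewrite [LHS](gft_inversion _ _ u_onb).
  by under [RHS]eq_bigr do rewrite !mxE sconjK.
Qed.

Lemma gft_neq0 (R : realType) (k : scalar_kind) (N : nat)
    (u : 'I_N -> 'cV[scalar_field R k]_N) (X : normedModType (scalar_field R k))
    (f : {ffun 'I_N -> X}) :
  orthonormal_basis u -> f != 0 -> gft u f != 0.
Proof.
move=> u_onb; apply: contra => /eqP hatf0; apply/eqP/ffunP => n.
rewrite (gft_inversion _ _ u_onb) hatf0 ffunE big1// => j _.
by rewrite ffunE scaler0.
Qed.

Lemma lpnorm_infty_ffun_gt0 (R : realType) (k : scalar_kind)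
    (V : normedZmodType (scalar_field R k)) (N : nat) (f : {ffun 'I_N -> V}) :
  f != 0 -> 0 < lpnorm +oo%E f.
Proof.
move=> f0; have [n fn0|f_eq0] := pickP (fun n => f n != 0).
  exact: lpnorm_infty_gt0 fn0.
by case/eqP: f0; apply/ffunP => n; rewrite ffunE; have /negbFE/eqP := f_eq0 n.
Qed.

(** The product of the two coherences may be replaced by any upper bound [d]:
this lets the special exponents be read off from the general estimate.
Positivity of [a] rules out a degenerate division by zero on both sides. *)
Lemma inv_le_ratio (R : realFieldType) (a b c d : R) :
  0 < a -> 0 <= b -> c <= d -> 0 <= c -> a <= c * b -> 1 / d <= b / a.
Proof.
move=> a0 b0 cd c0 acb; have d0 : 0 < d.
  rewrite lt_def (le_trans c0 cd) andbT; apply: contraTneq acb => d0.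
  suff -> : c = 0 by rewrite mul0r -ltNge.
  by apply/le_anti; rewrite c0 -d0 cd.
rewrite ler_pdivrMr// mulrAC ler_pdivlMr// mul1r mulrC.
by rewrite (le_trans acb)// ler_wpM2r.
Qed.

Theorem theorem3p1 (R : realType) (k : scalar_kind) (N : nat)
    (N_ge1 : (1 <= N)%N)
    (u : 'I_N -> 'cV[scalar_field R k]_N) (u_onb : orthonormal_basis u)
    (X : completeNormedModType (scalar_field R k))
    (f : {ffun 'I_N -> X}) (f_neq0 : f != 0) :
  let U := basis_mx u in
  let fhat := gft u f in
  (forall p : \bar R, (1 <= p)%E ->
     lpnorm p f * lpnorm p fhat / (lpnorm +oo%E f * lpnorm +oo%E fhat) >=
     1 / (coherence_r (hoelder_conjugate p) U *
          coherence_r (hoelder_conjugate p) (conj_trmx U))) /\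
  lpnorm 1%E f * lpnorm 1%E fhat / (lpnorm +oo%E f * lpnorm +oo%E fhat) >=
    1 / coherence U ^+ 2 /\
  lpnorm 2%:E f * lpnorm 2%:E fhat / (lpnorm +oo%E f * lpnorm +oo%E fhat) >= 1.
Proof.
move=> U fhat.
have prod_gt0 : 0 < lpnorm +oo%E f * lpnorm +oo%E fhat.
  by rewrite mulr_gt0// lpnorm_infty_ffun_gt0// gft_neq0.
have bound p c : (1 <= p)%E ->
    coherence_r (hoelder_conjugate p) U *
    coherence_r (hoelder_conjugate p) (conj_trmx U) <= c ->
    1 / c <= lpnorm p f * lpnorm p fhat / (lpnorm +oo%E f * lpnorm +oo%E fhat).
  move=> p1 kc; apply: inv_le_ratio prod_gt0 _ kc _ _.
  - by rewrite mulr_ge0// lpnorm_ge0.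
  - by rewrite mulr_ge0// coherence_r_ge0.
  - exact: lpnorm_infty_mul_le.
split; first by move=> p p1; exact: bound.
split.
  apply: bound => //; rewrite hoelder_conjugate1 !coherence_r_infty expr2.
  rewrite ler_wpM2l ?coherence_conj_trmx_le//.
  by rewrite -coherence_r_infty coherence_r_ge0.
(* unitarity gives both [U^* U = 1] and [U U^* = 1], one for each factor *)
have UU := conj_trmx_basis_mxK u_onb.
rewrite -[leLHS]divr1; apply: bound; first by rewrite lee_fin ler1n.
rewrite hoelder_conjugate2 mulr_ile1 ?coherence_r_ge0// ?coherence_r2_le1//.
by rewrite conj_trmxK mulmx1C.
Qed.
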